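(* Let $r\ge 2$ be an integer that is the order of some finite projective plane. Let $s\ge r^3+1$ and $t\in\{0,1,\dots,r\}$ be integers. Then \[ (r^2+r+1)s+t\;\le\;\operatorname{achr}\bigl(K_{r^2+r+1}\,\square\, K_{(r+1)s+t}\bigr)\;\le\;(r^2+r+1)s+rt. \]
   Context: A vertex colouring $f:V(G)\to C$ of a finite simple graph $G$ with a finite colour set $C$ is complete if for any two distinct colours $c_1,c_2\in C$ there are adjacent vertices $v_1,v_2$ with $f(v_1)=c_1$, $f(v_2)=c_2$. The achromatic number $\operatorname{achr}(G)$ is the maximum number of colours in a proper complete vertex colouring of $G$. The Cartesian product $G_1\square G_2$ has vertex set $V(G_1)\times V(G_2)$, with $(x_1,y_1)$ adjacent to $(x_2,y_2)$ iff either $x_1=x_2$ and $y_1y_2\in E(G_2)$, or $x_1x_2\in E(G_1)$ and $y_1=y_2$. For $r\ge2$, a finite projective plane of order $r$ is a pair $(P,\mathcal L)$ of a finite set $P$ of points and a set $\mathcal L$ of subsets of $P$ (lines) such that any two distinct points lie in exactly one common line, any two distinct lines intersect, there are four points no three of which lie on a common line (equivalently, the four points determine six distinct lines), and some line has exactly $r+1$ points; $r$ is a finite projective plane order if such a plane exists. *)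

(* Defs.v *)
From HB Require Import structures.
From mathcomp Require Import all_boot.

Set Implicit Arguments.
Unset Strict Implicit.
Unset Printing Implicit Defensive.

Record sgraph := SGraph {
  vertex :> finType;
  adj : rel vertex;
  adj_sym : symmetric adj;
  adj_irrefl : irreflexive adj }.

Lemma complete_adj_sym n : symmetric [rel i j : 'I_n | i != j].
Proof. by move=> i j /=; rewrite eq_sym. Qed.

Lemma complete_adj_irrefl n : irreflexive [rel i j : 'I_n | i != j].
Proof. by move=> i /=; rewrite eqxx. Qed.

Definition complete_graph (n : nat) : sgraph :=
  SGraph (@complete_adj_sym n) (@complete_adj_irrefl n).

Definition cartesian_adj (G1 G2 : sgraph) : rel (vertex G1 * vertex G2) :=
  [rel u v | (u.1 == v.1) && adj u.2 v.2 || adj u.1 v.1 && (u.2 == v.2)].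

Lemma cartesian_adj_sym G1 G2 : symmetric (@cartesian_adj G1 G2).
Proof.
move=> u v; rewrite /cartesian_adj /=.
by rewrite eq_sym [adj u.2 _]adj_sym [adj u.1 _]adj_sym [u.2 == _]eq_sym.
Qed.

Lemma cartesian_adj_irrefl G1 G2 : irreflexive (@cartesian_adj G1 G2).
Proof. by move=> u; rewrite /cartesian_adj /= !adj_irrefl andbF. Qed.

Definition cartesian_product (G1 G2 : sgraph) : sgraph :=
  SGraph (@cartesian_adj_sym G1 G2) (@cartesian_adj_irrefl G1 G2).

Definition proper_colouring (G : sgraph) (C : finType) (f : G -> C) : bool :=
  [forall v1, forall v2, adj v1 v2 ==> (f v1 != f v2)].

Definition complete_colouring (G : sgraph) (C : finType) (f : G -> C) : bool :=
  [forall c1, forall c2, (c1 != c2) ==>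
    [exists v1, exists v2, [&& adj v1 v2, f v1 == c1 & f v2 == c2]]].

(* A complete colouring with at least two colours is onto, so its number of   *)
(* colours is at most #|G|; the bound #|G|.+1 also admits the one-colour      *)
(* colouring of the empty graph.                                              *)
Definition achr (G : sgraph) : nat :=
  \max_(k < #|G|.+2 |
        [exists f : {ffun G -> 'I_k},
           proper_colouring f && complete_colouring f]) k.

Lemma complete_colouring_card (G : sgraph) (C : finType) (f : G -> C) :
  complete_colouring f -> #|C| < #|G|.+2.
Proof.
move=> cf; have [C1|C2] := leqP #|C| 1; first exact: leq_trans C1 _.
suff fsurj c : exists v, f v = c.
  rewrite ltnS ltnW // ltnS.
  pose h c := sval (sigW (let: ex_intro v e := fsurj c in
                     ex_intro (fun v => f v == c) v (introT eqP e))).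
  have hK : cancel h f by move=> c; rewrite /h; case: sigW => v /= /eqP.
  exact: leq_card (can_inj hK).
have /subsetPn[d _] : ~~ ([set: C] \subset [set c]).
  by apply/negP => /subset_leq_card; rewrite cardsT cards1 leqNgt C2.
rewrite inE => dc; move/forallP: cf => /(_ d)/forallP/(_ c).
by rewrite dc => /existsP[u /existsP[v /and3P[_ _ /eqP]]]; exists v.
Qed.

Lemma proper_colouring_inj (G : sgraph) (C D : finType) (f : G -> C)
    (h : C -> D) (g : G -> D) :
  injective h -> (forall v, g v = h (f v)) ->
  proper_colouring f -> proper_colouring g.
Proof.
move=> injh gE /forallP pf; apply/forallP => u; apply/forallP => v.
by rewrite !gE (inj_eq injh); move: (pf u) => /forallP.
Qed.

Lemma achr_max (G : sgraph) (C : finType) (f : G -> C) :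
  proper_colouring f -> complete_colouring f -> #|C| <= achr G.
Proof.
move=> pf cf; have ltC := complete_colouring_card cf.
apply: (@leq_bigmax_cond _ _ (fun k : 'I__ => k : nat) (Ordinal ltC)).
apply/existsP; exists [ffun v => enum_rank (f v)]; apply/andP; split.
  by apply: proper_colouring_inj enum_rank_inj _ pf => v; rewrite ffunE.
apply/forallP => c; apply/forallP => d; apply/implyP => cd.
move/forallP: cf => /(_ (enum_val c))/forallP/(_ (enum_val d)).
rewrite (inj_eq enum_val_inj) cd => /existsP[u /existsP[v /and3P[uv fu fv]]].
apply/existsP; exists u; apply/existsP; exists v.
by rewrite uv !ffunE (eqP fu) (eqP fv) !enum_valK !eqxx.
Qed.

(* A proper colouring with the fewest colours is complete: two colours with   *)
(* no edge between their classes could be merged.                             *)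
Lemma achr_attained (G : sgraph) :
  exists2 f : G -> 'I_(achr G), proper_colouring f & complete_colouring f.
Proof.
pose P k := [exists f : {ffun G -> 'I_k}, proper_colouring f].
have PC (C : finType) (f : G -> C) : proper_colouring f -> P #|C|.
  move=> pf; apply/existsP; exists [ffun v => enum_rank (f v)].
  by apply: proper_colouring_inj enum_rank_inj _ pf => v; rewrite ffunE.
have exP : exists k, P k.
  exists #|G|; apply: (PC _ id).
  apply/forallP => u; apply/forallP => v; apply/implyP; apply: contraTneq => ->.
  by rewrite adj_irrefl.
case: (ex_minnP exP) => m /existsP[f pf] mmin.
have cf : complete_colouring f.
  apply/forallP => c; apply/forallP => d; apply/implyP => cd.
  apply: contraT => nE.
  have gP v : (if f v == c then d else f v) != c.
    by case: ifP => [_|->//]; rewrite eq_sym.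
  pose g v : {x | x != c} := exist (fun x => x != c) _ (gP v).
  have /PC/mmin : proper_colouring g.
    apply/forallP => u; apply/forallP => v; apply/implyP => uv.
    apply/negP => /eqP/(congr1 val) /=.
    have fuv : f u != f v.
      by move/forallP: pf => /(_ u)/forallP/(_ v); rewrite uv.
    have nadj x y : adj x y -> f x = c -> f y = d -> False.
      move=> xy fx fy; case/negP: nE; apply/existsP; exists x.
      by apply/existsP; exists y; rewrite xy fx fy !eqxx.
    case: (eqVneq (f u) c) => fu; case: (eqVneq (f v) c) => fv e.
    - by rewrite fu fv eqxx in fuv.
    - exact: nadj uv fu (esym e).
    - by apply: nadj fv e; rewrite adj_sym.
    - by rewrite e eqxx in fuv.
  rewrite card_sig cardC1 card_ord.
  by case: (m) c {cd nE gP g f pf mmin} => [[]|k _] //; rewrite ltnn.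
have ltm : m < #|G|.+2 by rewrite -[m]card_ord; apply: complete_colouring_card cf.
pose Q (k : 'I_#|G|.+2) := [exists f : {ffun G -> 'I_k},
  proper_colouring f && complete_colouring f].
have Q0 : 0 < #|Q|.
  apply/card_gt0P; exists (Ordinal ltm); apply/existsP; exists f.
  by rewrite pf cf.
rewrite /achr; have [k Qk ->] := eq_bigmax_cond (fun k : 'I__ => k : nat) Q0.
by case/existsP: Qk => h /andP[]; exists h.
Qed.

Definition projective_plane (P : finType) (L : {set {set P}}) (r : nat) : Prop :=
  [/\ forall x y : P, x != y ->
        exists! l : {set P}, [/\ l \in L, x \in l & y \in l],
      forall l m : {set P}, l \in L -> m \in L -> l != m -> l :&: m != set0,
      exists2 Q : {set P}, #|Q| = 4 &
        forall l : {set P}, l \in L -> #|l :&: Q| <= 2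
    & exists2 l : {set P}, l \in L & #|l| = r.+1].

Definition projective_plane_order (r : nat) : Prop :=
  2 <= r /\ exists (P : finType) (L : {set {set P}}), projective_plane L r.

(* Main.v *)
Require Import Defs.
From mathcomp Require Import all_boot zify.

Set Implicit Arguments.
Unset Strict Implicit.
Unset Printing Implicit Defensive.

(* Write n = r^2 + r + 1 and m = (r + 1) s + t, and view a colouring as an n x m
   array.

   Upper bound: a colour occurring l times meets only colours in the l rows and
   l columns it occupies, so there are at most 1 + l (m + n - l - 1) colours; for
   l <= r this is at most n s + r t because s > r^3.  If every colour occurs at
   least r + 1 times, there are at most n m / (r + 1) < n s + r t + 1 colours.

   Lower bound: rows are the points of a projective plane, and the colours are
   s copies (b, a) of each line b together with t extra colours.  Row p carries
   the copies of the lines through p and all the extra colours, so any two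
   colours share a row.  With t = 0, put (b, a) in row p into column
   (j, a + p mod s) when b is the j-th line through p.  For each j < t, one cell
   of each row is then handed over to the j-th extra colour, its former colour
   moving to the j-th new column; the cells are chosen so that, for a fixed j, no
   two of them share a column and no two former colours have the same a. *)

Notation rook n m :=
  (cartesian_product (complete_graph n) (complete_graph m)).

(** * Counting points and lines in a finite projective plane *)

Section ProjectivePlane.

Variables (P : finType) (L : {set {set P}}) (r : nat).
Hypothesis planeL : projective_plane L r.

Let pencil (p : P) := [set l in L | p \in l].

Lemma line_through (x y : P) : x != y ->
  exists l, [/\ l \in L, x \in l & y \in l].
Proof. by case: planeL => /(_ x y) + _ _ _ => /[apply] -[l [Hl _]]; exists l. Qed.

Lemma line_unique (x y : P) (l m : {set P}) : x != y -> l \in L -> m \in L ->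
  x \in l -> y \in l -> x \in m -> y \in m -> l = m.
Proof.
case: planeL => /(_ x y) + _ _ _ => /[apply] -[k [_ Uk]] lL mL xl yl xm ym.
by rewrite -(Uk l) // -(Uk m).
Qed.

Lemma lines_meet (l m : {set P}) : l \in L -> m \in L -> l != m ->
  exists2 x, x \in l & x \in m.
Proof.
case: planeL => _ /(_ l m) + _ _ => /[apply]/[apply]/[apply] /set0Pn[x].
by rewrite inE => /andP[xl xm]; exists x.
Qed.

(** Joining [p] to the points of [l] is a bijection: every line through [p] meets [l], and only once
    because [l] misses [p]. *)
Lemma card_pencil (p : P) (l : {set P}) : l \in L -> p \notin l ->
  #|pencil p| = #|l|.
Proof.
move=> lL pl; have pP x : x \in l -> p != x by move=> xl; apply: contraNneq pl => ->.
pose join x := odflt set0 [pick m in pencil p | x \in m].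
have joinP x : x \in l -> (join x \in pencil p) && (x \in join x).
  move=> /pP px; rewrite /join; case: pickP => //= no.
  by have [m [mL pm xm]] := line_through px; have := no m; rewrite !inE mL pm xm.
suff -> : pencil p = join @: l.
  apply: card_in_imset => x y xl yl e.
  have [/andP[]] := (joinP x xl, joinP y yl); rewrite -e inE => /andP[mL pm] xm /andP[_ ym].
  case: (eqVneq x y) => // xy.
  by rewrite (line_unique xy lL mL) // pm in pl.
apply/setP => m; apply/idP/imsetP => [|[x xl ->]]; last by case/andP: (joinP x xl).
rewrite inE => /andP[mL pm]; have lm : l != m by apply: contraNneq pl => ->.
have [x xl xm] := lines_meet lL mL lm; exists x => //.
have /andP[] := joinP x xl; rewrite inE => /andP[jL pj] xj.
exact: line_unique (pP x xl) _ _ _ _ _ _.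
Qed.

(** If [l] and [m] cover the four points of [Q], two of these, [a] and [b], lie on [l] only and two,
    [c] and [d], on [m] only; then the lines [ac] and [bd] meet off both. *)
Lemma point_off_two_lines (l m : {set P}) : l \in L -> m \in L ->
  exists2 x, x \notin l & x \notin m.
Proof.
move=> lL mL; case: planeL => _ _ [Q Q4 QL] _.
case: (boolP [exists x in Q, (x \notin l) && (x \notin m)]) => [/exists_inP[x _ /andP[]]|].
  by exists x.
rewrite negb_exists_in => /forall_inP cov.
have two (k k' : {set P}) : k \in L -> (forall x, x \in Q -> (x \in k) || (x \in k')) ->
    exists a b, [/\ a != b, a \in k', b \in k', a \notin k & b \notin k].
  move=> kL kk'; have : 1 < #|Q :\: k|.
    by have := QL k kL; have := cardsID k Q; rewrite setIC; lia.
  move=> /card_gt1P[a [b []]]; rewrite !inE => /andP[ak aQ] /andP[bk bQ] ab.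
  by exists a, b; have := kk' a aQ; have := kk' b bQ; rewrite (negPf ak) (negPf bk).
have [|c [d [cd cm dm cl dl]]] := two l m lL.
  by move=> x /cov; rewrite negb_and !negbK.
have [|a [b [ab al bl am bm]]] := two m l mL.
  by move=> x /cov; rewrite negb_and !negbK orbC.
have ac : a != c by apply: contraNneq cl => <-.
have bd : b != d by apply: contraNneq dl => <-.
have [u [uL au cu]] := line_through ac.
have [v [vL bv dv]] := line_through bd.
have uv : u != v.
  by apply: contraNneq cl => uv; rewrite (line_unique ab lL uL) // uv.
have [x xu xv] := lines_meet uL vL uv; exists x; apply/negP => xk.
- case: (eqVneq x a) => xa; last first.
    by rewrite (line_unique xa lL uL) // cu in cl.
  by rewrite -xa in ab al; rewrite (line_unique ab lL vL) // dv in dl.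
- case: (eqVneq x c) => xc; last first.
    by rewrite (line_unique xc mL uL) // au in am.
  by rewrite -xc in cd cm; rewrite (line_unique cd mL vL) // bv in bm.
Qed.

(** Any two lines are both equinumerous with the pencil of a point outside them. *)
Lemma card_line (l : {set P}) : l \in L -> #|l| = r.+1.
Proof.
case: planeL => _ _ _ [m mL <-] lL.
have [x xl xm] := point_off_two_lines lL mL.
by rewrite -(card_pencil lL xl) (card_pencil mL xm).
Qed.

(** Take three points of [Q] other than [p]. If the lines [ab] and [ca] both passed through [p],
    they would coincide and hold three points of [Q]. *)
Lemma line_off_point (p : P) : exists2 l, l \in L & p \notin l.
Proof.
case: planeL => _ _ [Q Q4 QL] _.
have /card_gt2P [a [b [c [[]]]]] : 2 < #|Q :\ p| by have := cardsD1 p Q; lia.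
rewrite !inE => /andP[ap aQ] /andP[bp bQ] /andP[cp cQ] [ab bc ca].
have [l [lL al bl]] := line_through ab.
have [m [mL cm am]] := line_through ca.
case: (boolP (p \in l)) => pl; last by exists l.
case: (boolP (p \in m)) => pm; last by exists m.
have lm : l = m by apply: line_unique ap _ _ _ _ _ _.
have : 2 < #|l :&: Q|.
  by apply/card_gt2P; exists a, b, c; rewrite !inE al bl lm cm aQ bQ cQ.
by rewrite ltnNge QL.
Qed.

Lemma card_lines_through (p : P) : #|pencil p| = r.+1.
Proof.
by have [l lL pl] := line_off_point p; rewrite (card_pencil lL pl) card_line.
Qed.

(** Double counting of the pairs of a point other than [p] and a line joining it to [p]. *)
Lemma card_points : #|P| = r ^ 2 + r + 1.
Proof.
have [p _] : exists p : P, true.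
  case: planeL => _ _ [Q Q4 _] _; have /card_gt0P[p _] : 0 < #|Q| by rewrite Q4.
  by exists p.
suff : #|[set~ p]| = #|pencil p| * r.
  rewrite cardsC1 card_lines_through; have : 0 < #|P| by apply/card_gt0P; exists p.
  by nia.
transitivity (\sum_(x in [set~ p]) \sum_(l in pencil p | x \in l) 1).
  rewrite -sum1_card; apply: eq_bigr => x; rewrite !inE => xp.
  have [l [lL xl pl]] := line_through xp.
  rewrite (big_pred1 l) // => m; rewrite !inE; apply/idP/eqP => [|->]; last by rewrite lL pl xl.
  by move=> /andP[/andP[mL pm] xm]; apply: line_unique xp _ _ _ _ _ _.
rewrite (exchange_big_dep (mem (pencil p))) /=; last by move=> x l _ /andP[].
rewrite -sum_nat_const; apply: eq_bigr => l lp.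
have := lp; rewrite inE => /andP[lL pl].
have -> : r = #|l :\ p| by have := cardsD1 p l; rewrite pl card_line //; lia.
by rewrite -sum1_card; apply: eq_bigl => x; rewrite !inE lL pl.
Qed.

Lemma card_lines : #|L| = r ^ 2 + r + 1.
Proof.
apply/eqP; rewrite -(eqn_pmul2r (ltn0Sn r)) -card_points -!sum_nat_const; apply/eqP.
transitivity (\sum_(l in L) \sum_(x in l) 1).
  by apply: eq_bigr => l lL; rewrite sum1_card card_line.
rewrite (exchange_big_dep predT) //=; apply: eq_bigr => x _.
by rewrite sum1dep_card card_lines_through.
Qed.

(** The case [l = m] gives two copies of one line a common row. *)
Lemma two_lines_common_point (l m : {set P}) : l \in L -> m \in L ->
  exists2 x, x \in l & x \in m.
Proof.
move=> lL mL; case: (eqVneq l m) => [<-|]; last exact: lines_meet.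
have /card_gt0P[x xl] : 0 < #|l| by rewrite card_line.
by exists x.
Qed.

End ProjectivePlane.

(** * Colour classes and the upper bound *)

Section UpperBound.

Variables (n m : nat) (C : finType) (f : rook n m -> C).
Hypotheses (pf : proper_colouring f) (cf : complete_colouring f).

Let class c : {set 'I_n * 'I_m} := [set v | f v == c].

Lemma class_inj_row c : {in class c &, injective (fun v : 'I_n * 'I_m => v.1)}.
Proof.
move=> [i j] [i' j']; rewrite !inE /= => /eqP fu /eqP fv ii; rewrite -ii in fv *.
move/forallP: pf => /(_ (i, j))/forallP/(_ (i, j')).
move=> /implyP; rewrite /= /cartesian_adj /= fu fv !eqxx /= orbF.
by case: (eqVneq j j') => [->//|_ /(_ isT)].
Qed.

(** All neighbours of the class lie in [D], its rows together with its columns outside these rows;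
    the cells of the class itself, also in [D], carry no other colour. *)
Lemma complete_card_le c :
  #|C| + #|class c| <= 1 + #|class c| * m + (n - #|class c|) * #|class c|.
Proof.
set A := class c; set R := [set v.1 | v in A]; set S := [set v.2 | v in A].
have cR : #|R| = #|A| by apply: card_in_imset; apply: class_inj_row.
have cS : #|S| <= #|A| by apply: leq_imset_card.
set D := setX R [set: 'I_m] :|: setX (~: R) S.
have cD : #|D| <= #|A| * m + (n - #|A|) * #|A|.
  apply: leq_trans (leq_card_setU _ _) _; rewrite !cardsX cR cardsT card_ord.
  by rewrite leq_add2l cardsCs setCK card_ord cR leq_mul2l cS orbT.
have AD : A \subset D.
  apply/subsetP => v vA; rewrite !inE; have -> // : v.1 \in R.
  by apply/imsetP; exists v.
have sub : [set~ c] \subset [set f v | v in D :\: A].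
  apply/subsetP => d; rewrite !inE => dc.
  move/forallP: cf => /(_ c)/forallP/(_ d); rewrite eq_sym dc.
  move=> /existsP[u /existsP[v /and3P[uv /eqP fu /eqP fv]]].
  apply/imsetP; exists v => //; rewrite !inE fv dc /=.
  have uA : u \in A by rewrite inE fu.
  have uR : u.1 \in R by apply/imsetP; exists u.
  have uS : u.2 \in S by apply/imsetP; exists u.
  case/orP: uv => /andP[e1 e2]; first by rewrite -(eqP e1) uR.
  by rewrite -(eqP e2) uS; case: (v.1 \in R).
have := leq_trans (subset_leq_card sub) (leq_imset_card _ _).
rewrite cardsC1 (cardsDS AD) leq_subRL ?subset_leq_card // => h.
rewrite -[X in _ <= X]addnA addnC; apply: leq_trans (leq_add (leqnn 1) cD).
by move: h; rewrite add1n; case: #|C| => [/leqW|k] //; rewrite addnS.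
Qed.

Lemma card_colours_mul_le k : (forall c, k <= #|class c|) -> #|C| * k <= n * m.
Proof.
move=> kc; have <- : #|{: 'I_n * 'I_m}| = n * m by rewrite card_prod !card_ord.
rewrite -[leqRHS]sum1_card (partition_big f predT) //= -sum_nat_const.
by apply: leq_sum => c _; apply: leq_trans (kc c) _; rewrite -sum1dep_card.
Qed.

End UpperBound.

Lemma achr_rook_le (r s t : nat) : r ^ 3 + 1 <= s -> t <= r ->
  achr (rook (r ^ 2 + r + 1) ((r + 1) * s + t)) <= (r ^ 2 + r + 1) * s + r * t.
Proof.
move=> hs ht; set n := r ^ 2 + r + 1; set m := (r + 1) * s + t.
have [f pf cf] := achr_attained (rook n m); set K := achr _ in f pf cf *.
case: (boolP [forall c, r.+1 <= #|[set v | f v == c]|]) => [/forallP|].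
  move=> /card_colours_mul_le; rewrite card_ord => h.
  (* The remainder [t] is below [r + 1], so [n * m / (r + 1)] rounds down to exactly the required
     bound. *)
  have nmE : n * m = (n * s + r * t) * r.+1 + t by rewrite /n /m; nia.
  rewrite -ltnS -(ltn_pmul2r (ltn0Sn r)); apply: leq_ltn_trans h _.
  by rewrite nmE mulSn addnC ltn_add2r ltnS.
rewrite negb_forall => /existsP[c]; rewrite -leqNgt => lr.
have := complete_card_le pf cf c; rewrite card_ord.
move: (#|_|) lr => l lr.
(* In this form the term [r * m] absorbs [l * m], and what is left, at most [1 + r ^ 3], fits into
   [s] by [hs]. *)
have nsE : n * s + r * t = s + r * m by rewrite /n /m; nia.
have lm : l * m <= r * m by rewrite leq_mul2r lr orbT.
have nl : (n - l) * l <= r ^ 3 + l.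
  have -> : n - l = (r ^ 2 - l) + r + 1 by rewrite /n; nia.
  by rewrite !expnS; nia.
by rewrite nsE; lia.
Qed.

(** * Lower bound: colourings from row-wise placements of colours *)

(* [S p] is the set of colours used in row [p], and [pos p c] is the column in
   which row [p] carries the colour [c]. *)
Lemma card_le_achr_rook (T U C : finType) (S : T -> {set C}) (pos : T -> C -> U) :
  (forall p, #|S p| = #|U|) ->
  (forall p, {in S p &, injective (pos p)}) ->
  (forall c p q, c \in S p -> c \in S q -> pos p c = pos q c -> p = q) ->
  (forall c d, exists2 p, c \in S p & d \in S p) ->
  #|C| <= achr (rook #|T| #|U|).
Proof.
move=> cS injS injP meet.
(* Since [S p] has as many colours as there are columns, the injective [pos p] fills row [p]; [F]
   reads off the colour of a cell. *)
have /all_sig2[F FS FK] (w : T * U) : {c | c \in S w.1 & pos w.1 c = w.2}.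
  case: w => p u; suff /imsetP/sig2_eqW[c cp ->] : u \in pos p @: S p by exists c.
  suff -> : pos p @: S p = [set: U] by rewrite inE.
  by apply/eqP; rewrite eqEcard subsetT cardsT card_in_imset ?cS /=.
have KF p c : c \in S p -> F (p, pos p c) = c.
  by move=> cp; apply: (injS p) => //; rewrite ?(FK (_, _)) ?(FS (_, _)).
pose f (v : rook #|T| #|U|) := F (enum_val v.1, enum_val v.2).
apply: (achr_max (f := f)).
- apply/forallP => -[i j]; apply/forallP => -[i' j']; apply/implyP => /=.
  apply: contraTneq; rewrite /f /= => e; apply/negP => /orP[] /andP[].
    move=> /eqP /= ii; rewrite -ii in e; move/(congr1 (pos (enum_val i))): e.
    by rewrite (FK (_, _)) (FK (_, enum_val j')) => /enum_val_inj ->; rewrite eqxx.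
  move=> + /eqP /= jj; rewrite -jj in e.
  set p := enum_val i in e; set q := enum_val i' in e; set u := enum_val j in e.
  have Fq := FK (q, u); have Sq := FS (q, u).
  have /enum_val_inj -> : p = q; last by rewrite adj_irrefl.
  rewrite -e /= in Fq Sq; apply: injP (FS (p, u)) Sq _.
  by rewrite Fq (FK (p, u)).
- apply/forallP => c; apply/forallP => d; apply/implyP => cd.
  have [p cp dp] := meet c d.
  apply/existsP; exists (enum_rank p, enum_rank (pos p c)).
  apply/existsP; exists (enum_rank p, enum_rank (pos p d)).
  rewrite /f /= /cartesian_adj /= !enum_rankK !KF // !eqxx /= orbF !andbT.
  rewrite (inj_eq enum_rank_inj).
  by apply: contraNneq cd => /(injS p) ->.
Qed.

(** * Arithmetic of shifts modulo [s] *)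

(* For odd s, p + p is injective modulo s on [0, s); for even s its values repeat
   from p = s / 2 on, which adding 1 there repairs, at the cost of p = s - 1. *)
Definition alpha (s p : nat) := p + (~~ odd s && (s <= p.*2)).

Lemma alpha_inj s : injective (alpha s).
Proof. by move=> p q; rewrite /alpha; case: (odd s) => /=; lia. Qed.

Lemma alpha_lt s p : p.+1 < s -> alpha s p < s.
Proof. by rewrite /alpha; lia. Qed.

Lemma modn_inj_small s x y : x < s.*2 -> y < s.*2 -> x = y %[mod s] ->
  [\/ x = y, x = y + s | y = x + s].
Proof.
move=> xs ys e; have := divn_eq x s; have := divn_eq y s; rewrite e.
have : x %/ s < 2 by rewrite ltn_divLR; lia.
have : y %/ s < 2 by rewrite ltn_divLR; lia.
case: (x %/ s) => [|[|?]] //; case: (y %/ s) => [|[|?]] // _ _ ey ex.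
- by constructor 1; lia.
- by constructor 3; lia.
- by constructor 2; lia.
- by constructor 1; lia.
Qed.

(** Both sums are below [2 * s], so distinct ones would differ by [s]. For odd [s] both are even;
    for even [s] equal parity puts [p] and [q] in the same half, where sums differ by less than
    [s]. *)
Lemma alpha_add_inj s p q : p.+1 < s -> q.+1 < s ->
  alpha s p + p = alpha s q + q %[mod s] -> p = q.
Proof.
by move=> ps qs /modn_inj_small [||||]; rewrite /alpha; lia.
Qed.

(** * Lower bound: the colouring built from points and lines *)

(** Blocks stand for lines and [T] for points; [p0] supplies a row shared by two extra colours. *)
Lemma card_le_achr_design (T B : finType) (inc : T -> {set B}) (k s t : nat)
    (p0 : T) :
  (forall p, #|inc p| = k.+1) ->
  (forall b c, exists2 p, b \in inc p & c \in inc p) ->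
  t <= k.+1 -> #|T| < s ->
  #|B| * s + t <= achr (rook #|T| (k.+1 * s + t)).
Proof.
move=> cinc meet tk; case: s => // s Ts.
pose C : finType := (B * 'I_s.+1 + 'I_t)%type.
pose U : finType := ('I_k.+1 * 'I_s.+1 + 'I_t)%type.
have <- : #|C| = #|B| * s.+1 + t by rewrite card_sum card_prod !card_ord.
have cU : #|U| = k.+1 * s.+1 + t by rewrite card_sum card_prod !card_ord.
rewrite -cU.
pose c (p : T) : nat := enum_rank p.
have cs p : (c p).+1 < s.+1 by apply: leq_ltn_trans Ts; apply: ltn_ord.
have c_inj : injective c by move=> p q /val_inj/enum_rank_inj.
pose S p : {set C} := [set x | if x is inl (b, _) then b \in inc p else true].
pose ix p b : nat := index b (enum (inc p)).
have ix_lt p b : b \in inc p -> ix p b < k.+1.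
  by move=> bp; rewrite -(cinc p) cardE index_mem mem_enum.
have ix_inj p b b' : b \in inc p -> b' \in inc p -> ix p b = ix p b' -> b = b'.
  move=> bp b'p /(congr1 (nth b (enum (inc p)))).
  by rewrite !nth_index // mem_enum.
(* In row p, the colour (b, a) moves to the new column j when b is the j-th
   block at p and a = alpha p; the extra colour j takes the vacated cell. *)
pose home j a p : U := inl (inord j, inord ((a + c p) %% s.+1)).
pose pos p (x : C) : U := match x with
  | inl (b, a) =>
      match insub (ix p b) : option 'I_t with
      | Some j => if a == alpha s.+1 (c p) :> nat then inr j else home (ix p b) a p
      | None => home (ix p b) a p
      end
  | inr e => home e (alpha s.+1 (c p)) p
  end.
(* [inord] sends out-of-range values to 0, whence the bounds on [j] and [j']. *)
have homeE j a p j' a' p' : j < k.+1 -> j' < k.+1 -> home j a p = home j' a' p' ->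
    j = j' /\ a + c p = a' + c p' %[mod s.+1].
  move=> jk jk' [/(congr1 val) /= + /(congr1 val) /=].
  by rewrite !inordK ?ltn_pmod.
have posP p b (a : 'I_s.+1) :
    (exists j : 'I_t, [/\ pos p (inl (b, a)) = inr j, ix p b = j
       & a = alpha s.+1 (c p) :> nat]) \/
    (pos p (inl (b, a)) = home (ix p b) a p
       /\ ~ (ix p b < t /\ a = alpha s.+1 (c p) :> nat)).
  rewrite /=; case: insubP => [j _ <-|]; last first.
    by move=> it; right; split=> // -[it']; rewrite it' in it.
  case: eqP => aE; [by left; exists j | by right; split=> // -[]].
have acS p : alpha s.+1 (c p) < s.+1 by apply: alpha_lt.
have modI (a a' : 'I_s.+1) p : a + c p = a' + c p %[mod s.+1] -> a = a'.
  by move/eqP; rewrite eqn_modDr !modn_small // => /eqP/val_inj.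
apply: (@card_le_achr_rook T U C S pos).
- move=> p; rewrite cU -sum1_card big_sumType /=.
  congr (_ + _); last first.
    rewrite -[RHS]card_ord -sum1_card; apply: eq_bigl => e.
    by rewrite !inE.
  transitivity (\sum_(b in inc p) \sum_(a < s.+1) 1).
    rewrite pair_big_dep /=; apply: eq_bigl => -[b a].
    by rewrite !inE andbT.
  rewrite -(cinc p) -sum_nat_const; apply: eq_bigr => b _.
  by rewrite sum1_card card_ord.
(* The only copy whose home is the cell taken by the extra colour [e] is the one that moved to the
   new column [e]. *)
- have half p b (a : 'I_s.+1) (e : 'I_t) : b \in inc p ->
      pos p (inl (b, a)) <> pos p (inr e).
    move=> bp; case: (posP p b a) => [[j [-> //]]|[-> no]].
    move=> /homeE[||ie]; rewrite ?ix_lt //; first exact: leq_trans tk.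
    move=> am; apply: no; split; first by rewrite ie.
    by rewrite (modI a (Ordinal (acS p)) p am).
  move=> p [[b a]|e] [[b' a']|e']; rewrite !inE => bp b'p pe.
  + case: (posP p b a) pe => [[j [-> ij aE]]|[-> no]];
    case: (posP p b' a') => [[j' [-> ij' aE']]|[-> no']] // pe.
    * have -> : b = b' by apply: (@ix_inj p); rewrite // ij ij'; case: pe => ->.
      by congr (inl (_, _)); apply: val_inj; rewrite /= aE aE'.
    * have [||ie /modI ->] := homeE _ _ _ _ _ _ _ _ pe; rewrite ?ix_lt //.
      by rewrite (ix_inj p b b').
  + by case: (half p b a e').
  + by case: (half p b' a' e).
  + have [||/val_inj -> //] := homeE _ _ _ _ _ _ _ _ pe; exact: leq_trans tk.
(* If the copy has moved in both rows, [a] determines the row through [alpha]; if it is at home in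
   both, the shift by [c p] does. For an extra colour, [alpha] plus the shift does. *)
- move=> [[b a]|e] p q; rewrite !inE => bp bq pe.
  + case: (posP p b a) pe => [[j [-> ij aE]]|[-> no]];
    case: (posP q b a) => [[j' [-> ij' aE']]|[-> no']] // pe.
    * by apply: c_inj; apply: (@alpha_inj s.+1); rewrite -aE -aE'.
    * have [||_ /eqP] := homeE _ _ _ _ _ _ _ _ pe; rewrite ?ix_lt //.
      by rewrite eqn_modDl !modn_small ?(ltnW (cs _)) // => /eqP/c_inj.
  + have [||_] := homeE _ _ _ _ _ _ _ _ pe; try exact: leq_trans tk.
    by move/alpha_add_inj => H; apply/c_inj/H.
- move=> [[b a]|e] [[b' a']|e'].
  + by have [p] := meet b b'; exists p; rewrite inE.
  + by have [p] := meet b b; exists p; rewrite inE.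
  + by have [p] := meet b' b'; exists p; rewrite inE.
  + by exists p0; rewrite inE.
Qed.

Theorem theorem3p1 (r s t : nat) (hr : 2 <= r) (hP : projective_plane_order r)
    (hs : r ^ 3 + 1 <= s) (ht : t <= r) :
  (r ^ 2 + r + 1) * s + t
    <= achr (cartesian_product (complete_graph (r ^ 2 + r + 1))
                               (complete_graph ((r + 1) * s + t)))
    <= (r ^ 2 + r + 1) * s + r * t.
Proof.
rewrite achr_rook_le // andbT.
case: hP => _ [P [L planeL]].
pose line : finType := {l : {set P} | l \in L}.
pose inc (p : P) : {set line} := [set l : line | p \in val l].
have cline : #|line| = r ^ 2 + r + 1 by rewrite card_sig -(card_lines planeL).
have cP := card_points planeL.
have /card_gt0P[p0 _] : 0 < #|P| by rewrite cP addn1.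
(* The first [r ^ 2 + r + 1] counts lines, for the colours; the other counts points, for the
   rows. *)
rewrite -{1}cline -cP addn1.
apply: (card_le_achr_design (inc := inc)) => //.
- move=> p; rewrite -(card_lines_through planeL p) -(card_imset _ val_inj).
  apply: eq_card => l; rewrite inE; apply/imsetP/andP => [[x + ->]|[lL pl]].
    by rewrite inE; split=> //; apply: valP.
  by exists (exist _ l lL); rewrite ?inE.
- move=> b c; have [p pb pc] := two_lines_common_point planeL (valP b) (valP c).
  by exists p; rewrite inE.
- exact: leqW.
(* Here [2 <= r] gives [r ^ 2 + r < r ^ 3], so there are fewer points than [s]. *)
- by rewrite cP; move: hs; rewrite !expnS; nia.
Qed.
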